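(* Suppose that $F$ is a multiplicatively Archimedean fully preordered semifield with nontrivial preorder on $F^\times$. Then $F$ is of exactly one of the following five types: max-tropical, max-temperate, arctic, min-temperate, min-tropical.
   Context: All semirings are commutative with $0$ (absorbing) and $1$; $\mathbb{N}\ni0$. A semifield is a semiring $F$ whose multiplicatively invertible elements are exactly the nonzero ones; $F^\times=F\setminus\{0\}$. For a preorder $\le$: $x\approx y$ means $x\le y$ and $y\le x$; $x<y$ means $x\le y$ and not $y\le x$; $\sim$ is the equivalence relation generated by $\le$. A preordered semifield is a semifield with a preorder such that addition by $a$ and multiplication by $a$ are monotone for every $a$, and such that $x\approx0$ implies $x=0$. The preorder is full (and $F$ is fully preordered) if $x\sim y$ implies $x\le y$ or $x\ge y$. $F$ is multiplicatively Archimedean if for all $x,y\in F^\times$: if $x^k\le y$ for all $k\in\mathbb{N}$, then $x\le1$. The preorder on $F^\times$ is nontrivial if there is $x\in F^\times$ with $x>1$. A preordered semifield $F$ is: (i) max-tropical if $x+x^{-1}\approx2x$, (ii) max-temperate if $2<x+x^{-1}<2x$, (iii) arctic if $x+x^{-1}\approx2$, (iv) min-temperate if $2x^{-1}<x+x^{-1}<2$, (v) min-tropical if $x+x^{-1}\approx2x^{-1}$, holds for all $x\in F^\times$ with $x>1$. *)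

(* Defs.v *)
From HB Require Import structures.
From mathcomp Require Import all_boot all_order all_algebra.
From Stdlib Require Import Relation_Definitions Relation_Operators.

Set Implicit Arguments.
Unset Strict Implicit.
Unset Printing Implicit Defensive.

Import GRing.Theory.

Declare Scope semifield_scope.
Delimit Scope semifield_scope with SF.

Local Open Scope ring_scope.

(* The two axioms say that the invertible elements are exactly the nonzero
   ones; the second one forces 1 != 0 (take x = y = 1).  The value
   [sfinv 0] is unconstrained.  MathComp's [x^-1] cannot be used, as it is
   tied to structures with subtraction. *)
HB.mixin Record ComPzSemiRing_isSemifield F of GRing.ComPzSemiRing F := {
  sfinv : F -> F;
  mulf_sfinv : forall x : F, x != 0 -> x * sfinv x = 1;
  invertible_neq0 : forall x y : F, x * y = 1 -> x != 0
}.

#[short(type="semifieldType")]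
HB.structure Definition Semifield :=
  { F of ComPzSemiRing_isSemifield F & GRing.ComPzSemiRing F }.

(* The preorder is a Prop-valued field rather than a MathComp [preorderType]:
   Hierarchy Builder refuses a structure joining [Order.Preorder] with an
   additive structure above [Num.POrderedZmodule].  Neither antisymmetry nor
   [0 <= 1] is required. *)
Record preorderedSemifield := PreorderedSemifield {
  ps_sort :> semifieldType;
  sle : relation ps_sort;
  sle_preorder : preorder ps_sort sle;
  sle_add2l : forall a x y : ps_sort, sle x y -> sle (a + x) (a + y);
  sle_mul2l : forall a x y : ps_sort, sle x y -> sle (a * x) (a * y);
  sle_equiv0 : forall x : ps_sort, sle x 0 -> sle 0 x -> x = 0
}.

Definition slt (F : preorderedSemifield) (x y : F) : Prop :=
  sle x y /\ ~ sle y x.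

Definition sequiv (F : preorderedSemifield) (x y : F) : Prop :=
  sle x y /\ sle y x.

Definition sconn (F : preorderedSemifield) : relation F :=
  clos_refl_sym_trans F (@sle F).

Notation "x <= y" := (sle x y) : semifield_scope.
Notation "x < y" := (slt x y) : semifield_scope.
Notation "x < y < z" := (slt x y /\ slt y z) : semifield_scope.
Notation "x ≈ y" := (sequiv x y) (at level 70, no associativity)
  : semifield_scope.
Notation "x ∼ y" := (sconn x y) (at level 70, no associativity)
  : semifield_scope.

Local Open Scope semifield_scope.

Section Properties.
Variable F : preorderedSemifield.

Definition fully_preordered : Prop :=
  forall x y : F, x ∼ y -> x <= y \/ y <= x.

Definition mul_archimedean : Prop :=
  forall x y : F, x != 0 -> y != 0 -> (forall k : nat, x ^+ k <= y) -> x <= 1.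

(* Here and below, [x != 0] does not follow from [1 < x]: the axioms allow
   [1 < 0]. *)
Definition nontrivially_preordered : Prop :=
  exists x : F, x != 0 /\ 1 < x.

Definition max_tropical : Prop :=
  forall x : F, x != 0 -> 1 < x -> x + sfinv x ≈ 2 * x.

Definition max_temperate : Prop :=
  forall x : F, x != 0 -> 1 < x -> 2 < x + sfinv x < 2 * x.

Definition arctic : Prop :=
  forall x : F, x != 0 -> 1 < x -> x + sfinv x ≈ 2.

Definition min_temperate : Prop :=
  forall x : F, x != 0 -> 1 < x -> 2 * sfinv x < x + sfinv x < 2.

Definition min_tropical : Prop :=
  forall x : F, x != 0 -> 1 < x -> x + sfinv x ≈ 2 * sfinv x.

End Properties.

Inductive semifield_kind : Set :=
  MaxTropical | MaxTemperate | Arctic | MinTemperate | MinTropical.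

Definition of_kind (F : preorderedSemifield) (t : semifield_kind) : Prop :=
  match t with
  | MaxTropical => max_tropical F
  | MaxTemperate => max_temperate F
  | Arctic => arctic F
  | MinTemperate => min_temperate F
  | MinTropical => min_tropical F
  end.

(* Main.v *)
Require Import Defs.
From mathcomp Require Import all_boot all_algebra.
From Stdlib Require Import Classical Relation_Definitions Relation_Operators.

Set Implicit Arguments.
Unset Strict Implicit.
Unset Printing Implicit Defensive.

Import GRing.Theory.

(** Everything is read off the numbers [a n = x ^+ n + x ^- n] with [x > 1],
    which obey the recurrence of the hyperbolic cosine,
    [a 1 * a (n + 1) = a (n + 2) + a n] ([cosh2_mul]), with [a 0 = 2].  The
    extreme comparisons [2 x^-1 <= a 1 <= 2 x] always hold, so the content is
    that the way [a 1] compares with [2 x^-1], [2] and [2 x] does not depend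
    on [x].

    Reversing the preorder exchanges [x] and [x^-1], hence the max- and the
    min-types, and preserves all hypotheses; only half of each argument is
    needed.

    Tropicality propagates from a single point: the [y >= 1] with
    [1 + y ≈ 2 y] are closed under products ([absorbs_mul]) and downward
    closed ([absorbs_le]), so by the Archimedean property one [y > 1] of this
    kind makes [F] max-tropical ([max_tropical_of_absorbing]).  Therefore, if
    [F] is not tropical, a weak form of additive cancellation is available:
    [c + c <= b + c] implies [c <= b], because otherwise [y = c / b] would
    satisfy [1 + y ≈ 2 y] ([sle_addI_max]; dually [sle_addI_min]).

    In the non-tropical case the recurrence can then be exploited.  If
    [a 1 >= 2], it says that [a] is convex, whence [a] is nondecreasing and
    [a n >= 2] for all [n].  If [a 1 < 2], it gives
    [2 * a (n + 1) <= a 1 * a n] ([cosh2_decay]), so [a] decays exponentially.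
    These behaviours cannot coexist for two elements [x] and [z]: every large
    power of [x] lies between consecutive powers of [z], hence [a n] for [x]
    is at most [z] times some [a m] for [z], which is too small
    ([add_sfinv_lt2]).  So [x + x^-1 < 2] holds for all [x > 1] or for none,
    dually for [2 < x + x^-1], and if both fail then [F] is arctic. *)

Local Open Scope ring_scope.
Local Open Scope semifield_scope.

(** * Arithmetic and order in a preordered semifield *)

Section Arithmetic.
Variable F : semifieldType.
Implicit Types x y : F.

Lemma sfmulV x : x != 0 -> x * sfinv x = 1.
Proof. exact: mulf_sfinv. Qed.

Lemma sfinv_neq0 x : x != 0 -> sfinv x != 0.
Proof.
by move=> x0; apply: (@invertible_neq0 _ _ x); rewrite mulrC sfmulV.
Qed.

Lemma sfmul_neq0 x y : x != 0 -> y != 0 -> x * y != 0.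
Proof.
move=> x0 y0; apply: (@invertible_neq0 _ _ (sfinv x * sfinv y)).
by rewrite mulrACA !sfmulV // mulr1.
Qed.

Lemma sfexp_neq0 x n : x != 0 -> x ^+ n != 0.
Proof.
move=> x0; elim: n => [|n IHn]; last by rewrite exprS sfmul_neq0.
by rewrite expr0; apply: (@invertible_neq0 _ _ 1); rewrite mulr1.
Qed.

Lemma sfinvK x : x != 0 -> sfinv (sfinv x) = x.
Proof.
move=> x0; rewrite -[RHS]mulr1 -(sfmulV (sfinv_neq0 x0)).
by rewrite mulrA sfmulV // mul1r.
Qed.

End Arithmetic.

Section Order.
Variable F : preorderedSemifield.
Implicit Types a b c x y z : F.

Lemma slexx x : x <= x.
Proof. exact: (preord_refl _ _ (sle_preorder F)). Qed.

Lemma sle_trans y x z : x <= y -> y <= z -> x <= z.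
Proof. exact: (preord_trans _ _ (sle_preorder F)). Qed.

Lemma sle_add2r a x y : x <= y -> x + a <= y + a.
Proof. by move=> xy; rewrite ![_ + a]addrC; apply: sle_add2l. Qed.

Lemma sle_mul2r a x y : x <= y -> x * a <= y * a.
Proof. by move=> xy; rewrite ![_ * a]mulrC; apply: sle_mul2l. Qed.

Lemma sle_add a b x y : a <= b -> x <= y -> a + x <= b + y.
Proof.
by move=> ab xy; apply: (sle_trans (sle_add2r x ab)); apply: sle_add2l.
Qed.

Lemma sle_mul a b x y : a <= b -> x <= y -> a * x <= b * y.
Proof.
by move=> ab xy; apply: (sle_trans (sle_mul2r x ab)); apply: sle_mul2l.
Qed.

Lemma sle_mulI c x y : c != 0 -> c * x <= c * y -> x <= y.
Proof.
move=> c0 /(sle_mul2l (sfinv c)).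
by rewrite !mulrA [sfinv c * c]mulrC sfmulV // !mul1r.
Qed.

Lemma sle_exp n x y : x <= y -> x ^+ n <= y ^+ n.
Proof.
move=> xy; elim: n => [|n IHn]; first exact: slexx.
by rewrite !exprS; apply: sle_mul.
Qed.

Lemma sexp_ge1 n x : 1 <= x -> 1 <= x ^+ n.
Proof. by move=> /(sle_exp n); rewrite expr1n. Qed.

Lemma sle_inverse x x' y y' : x * x' = 1 -> y * y' = 1 -> x <= y -> y' <= x'.
Proof.
move=> xx' yy' /(sle_mul2l (x' * y')).
by rewrite mulrAC [x' * x]mulrC xx' mul1r -mulrA [y' * y]mulrC yy' mulr1.
Qed.

Lemma sfinv_lt1 x : x != 0 -> 1 < x -> sfinv x < 1.
Proof.
move=> x0 [le1x nlex1]; split.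
  by have := sle_inverse (mulr1 (1 : F)) (sfmulV x0) le1x.
have xx : sfinv x * x = 1 by rewrite mulrC sfmulV.
by move=> h; apply: nlex1; have := sle_inverse (mulr1 (1 : F)) xx h.
Qed.

Lemma sconn_le x y : x <= y -> x ∼ y.
Proof. exact: rst_step. Qed.

Lemma sconn_sym x y : x ∼ y -> y ∼ x.
Proof. exact: rst_sym. Qed.

Lemma sconn_trans y x z : x ∼ y -> y ∼ z -> x ∼ z.
Proof. exact: rst_trans. Qed.

(** Fullness compares connected elements only, so every case distinction rests
    on [∼] being a congruence. *)
Lemma sconn_add a b x y : a ∼ b -> x ∼ y -> a + x ∼ b + y.
Proof.
have add2l (u v w : F) : v ∼ w -> u + v ∼ u + w.
  elim=> [p q pq|p|p q _|p q r _ pq _]; last exact: rst_trans.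
  - by apply: sconn_le; apply: sle_add2l.
  - exact: rst_refl.
  - exact: rst_sym.
move=> ab xy; apply: sconn_trans (add2l b _ _ xy).
by rewrite ![_ + x]addrC; apply: add2l.
Qed.

Lemma sconn_mul a b x y : a ∼ b -> x ∼ y -> a * x ∼ b * y.
Proof.
have mul2l (u v w : F) : v ∼ w -> u * v ∼ u * w.
  elim=> [p q pq|p|p q _|p q r _ pq _]; last exact: rst_trans.
  - by apply: sconn_le; apply: sle_mul2l.
  - exact: rst_refl.
  - exact: rst_sym.
move=> ab xy; apply: sconn_trans (mul2l b _ _ xy).
by rewrite ![_ * x]mulrC; apply: mul2l.
Qed.

Lemma sconn_exp n x : x ∼ 1 -> x ^+ n ∼ 1.
Proof.
move=> x1; elim: n => [|n IHn]; first exact: rst_refl.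
by rewrite exprS -[1 in X in _ ∼ X](mulr1 1); apply: sconn_mul.
Qed.

Lemma fully_le_or_lt x y : fully_preordered F -> x ∼ y -> x <= y \/ y < x.
Proof.
by move=> full /full [] yx; [left | case: (classic (x <= y)); [left | right]].
Qed.

End Order.

(** * Reversing the preorder *)

Section Opposite.
Variable F : preorderedSemifield.

Definition opposite : preorderedSemifield.
Proof.
refine (@PreorderedSemifield F (fun x y => y <= x) _ _ _ _).
- by split=> [x | x y z xy yz]; [apply: slexx | apply: sle_trans yz xy].
- by move=> a x y; apply: sle_add2l.
- by move=> a x y; apply: sle_mul2l.
- by move=> x x0 /sle_equiv0; apply.
Defined.

Lemma sconn_opposite (x y : F) : sconn (F := opposite) x y <-> x ∼ y.
Proof.
split; (elim=> *; [ apply: rst_sym; exact: rst_step | exact: rst_refl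
                  | exact: rst_sym | apply: rst_trans; eassumption ]).
Qed.

Lemma fully_preordered_opposite :
  fully_preordered F -> fully_preordered opposite.
Proof. by move=> full x y /sconn_opposite /full []; [right | left]. Qed.

Lemma mul_archimedean_opposite : mul_archimedean F -> mul_archimedean opposite.
Proof.
move=> arch x y x0 y0 yx; have xV := sfmulV x0.
have pow k : (x : F) ^+ k * sfinv x ^+ k = 1 by rewrite -exprMn xV expr1n.
have x'1 := arch _ _ (sfinv_neq0 x0) (sfinv_neq0 y0)
  (fun k => @sle_inverse F _ _ _ _ (sfmulV y0) (pow k) (yx k)).
by rewrite mulrC in xV; have := @sle_inverse F _ _ _ _ xV (mulr1 (1 : F)) x'1.
Qed.

Lemma nontrivially_preordered_opposite :
  nontrivially_preordered F -> nontrivially_preordered opposite.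
Proof.
case=> x [x0 x1]; exists (sfinv x : F).
by split; [apply: sfinv_neq0 | case: (sfinv_lt1 x0 x1)].
Qed.

Lemma max_tropical_opposite : max_tropical opposite -> min_tropical F.
Proof.
move=> h x x0 x1; move: (h _ (sfinv_neq0 x0) (sfinv_lt1 x0 x1)).
by case; rewrite /sle /= sfinvK // addrC; split.
Qed.

Lemma min_tropical_opposite : min_tropical opposite -> max_tropical F.
Proof.
move=> h x x0 x1; move: (h _ (sfinv_neq0 x0) (sfinv_lt1 x0 x1)).
by case; rewrite /sle /= sfinvK // addrC; split.
Qed.

Lemma min_temperate_opposite : min_temperate opposite -> max_temperate F.
Proof.
move=> h x x0 x1; move: (h _ (sfinv_neq0 x0) (sfinv_lt1 x0 x1)).
by rewrite /slt /sle /= sfinvK // [sfinv x + x]addrC; case=> [] [] ? ? [] ? ?.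
Qed.

End Opposite.

(** * Tropicality propagates from one element *)

Section Nontrivial.
Variable F : preorderedSemifield.
Hypothesis nontriv : nontrivially_preordered F.
Implicit Types b c x y w v : F.

(** If [x + y = 0] then [-1 = y / x] exists, and monotonicity of multiplication
    by [-1] turns [1 <= g] into [g <= 1].  Thus [g - 1 ≈ 0], so [g = 1],
    contradicting [1 < g]. *)
Lemma sfadd_neq0 x y : x != 0 -> x + y != 0.
Proof.
move=> x0; apply/eqP=> xy0; case: nontriv => g [g0 [le1g nleg1]].
(* [n] plays the role of [-1]. *)
pose n := sfinv x * y.
have n1 : n + 1 = 0.
  by rewrite addrC /n -(sfmulV x0) mulrC -mulrDr xy0 mulr0.
have gn0 : g + n = 0.
  apply: sle_equiv0.
    have := sle_add2r g (sle_mul2l n le1g).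
    by rewrite mulr1 -[X in _ <= _ + X]mul1r -mulrDl n1 mul0r addrC.
  by have := sle_add2r n le1g; rewrite [1 + n]addrC n1.
by apply: nleg1; rewrite -[g]addr0 -n1 addrA gn0 add0r; apply: slexx.
Qed.

Lemma sf1_neq0 : 1 != 0 :> F.
Proof. by apply: (@invertible_neq0 _ _ 1); rewrite mulr1. Qed.

Lemma sf2_neq0 : 2 != 0 :> F.
Proof. by rewrite mulr2n sfadd_neq0 // sf1_neq0. Qed.

(** Doubling provides enough copies of [1] to replace them one at a time:
    [2 + 2 y w >= 2 + (y + y w) >= 2 y + (y + y w) >= 2 y + 2 y w >= 4 y w],
    where the second step is [1 + 1 + y >= 1 + 2 y >= 3 y] and the last two
    use [y + y w >= 2 y w]. *)
Lemma absorbs_mul y w : 1 <= w ->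
  y + y <= 1 + y -> w + w <= 1 + w -> y * w + y * w <= 1 + y * w.
Proof.
move=> w1 hy hw; apply: (sle_mulI sf2_neq0); rewrite !mulr_natl !mulr2n.
have {}hw : y * w + y * w <= y + y * w.
  by have := sle_mul2l y hw; rewrite !mulrDr mulr1.
have yw : y <= y * w by have := sle_mul2l y w1; rewrite mulr1.
have h1 : 1 + 1 + (y + y * w) <= 1 + y * w + (1 + y * w).
  by rewrite [X in _ <= X]addrACA; apply: sle_add2l; apply: sle_add2r.
apply: sle_trans h1.
have h2 : y + y + (y + y * w) <= 1 + 1 + (y + y * w).
  rewrite [1 + 1 + _]addrA -[1 + 1 + y]addrA.
  apply: (@sle_trans _ (1 + (y + y) + y * w)); last first.
    by apply: sle_add2r; apply: sle_add2l.
  by rewrite [1 + (y + y)]addrA addrA; apply: sle_add2r; apply: sle_add2r.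
apply: sle_trans h2.
apply: (@sle_trans _ (y + y + (y * w + y * w))); last exact: sle_add2l.
rewrite addrACA [X in _ <= X]addrACA.
by apply: sle_add.
Qed.

(** With [v = z * w] and [z >= 1], the sum [z + v] lies between [1 + v] and
    [2 v], so [z + z w ≈ 2 z w], and [z] can be divided out. *)
Lemma absorbs_le w v : w != 0 -> 1 <= w -> w <= v ->
  v + v <= 1 + v -> w + w <= 1 + w.
Proof.
move=> w0 w1 wv hv; have ww := sfmulV w0.
pose z := sfinv w * v.
have vE : v = z * w by rewrite /z mulrC mulrA ww mul1r.
have z1 : 1 <= z.
  by have := sle_mul2l (sfinv w) wv; rewrite [sfinv w * w]mulrC ww.
have v0 : v != 0.
  apply/eqP=> v0; move: wv hv; rewrite v0 !addr0 => w_le0 le01.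
  by case/eqP: w0; apply: sle_equiv0 w_le0 _; apply: sle_trans le01 w1.
have z0 : z != 0 by apply: sfmul_neq0 (sfinv_neq0 w0) v0.
apply: (sle_mulI z0); rewrite !mulrDr mulr1 -vE.
by apply: (sle_trans hv); apply: sle_add2r.
Qed.

Hypothesis full : fully_preordered F.
Hypothesis arch : mul_archimedean F.

Lemma archimedean_pow x y : x != 0 -> y != 0 -> 1 < x -> y ∼ 1 ->
  exists k, y <= x ^+ k.
Proof.
move=> x0 y0 [le1x nlex1] y1; apply: NNPP => no; apply: nlex1.
apply: (arch x0 y0) => k.
have /(fully_le_or_lt full) [yx | []//] : y ∼ x ^+ k.
  apply: sconn_trans y1 _; apply: sconn_le; exact: sexp_ge1.
by case: no; exists k.
Qed.

(** The powers of [y] are absorbing and unbounded, so for [x > 1] the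
    element [x * x] lies below one of them and [1 + x * x ≈ 2 (x * x)];
    dividing by [x] gives the claim. *)
Lemma max_tropical_of_absorbing y : y != 0 -> 1 < y -> y + y <= 1 + y ->
  max_tropical F.
Proof.
move=> y0 y1 hy x x0 x1; have [le1x _] := x1; have xx := sfmulV x0.
have [x'1 _] := sfinv_lt1 x0 x1.
have powers k : y ^+ k + y ^+ k <= 1 + y ^+ k.
  elim: k => [|k IHk]; first exact: slexx.
  by rewrite exprSr; apply: absorbs_mul hy => //; case: y1.
have x2_ge1 : 1 <= x * x by have := sexp_ge1 2 le1x; rewrite expr2.
have [k hk] : exists k, x * x <= y ^+ k.
  apply: archimedean_pow => //; first exact: sfmul_neq0.
  by apply: sconn_sym; apply: sconn_le.
have := absorbs_le (sfmul_neq0 x0 x0) x2_ge1 hk (powers k).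
move/(sle_mul2l (sfinv x)); rewrite !mulrDr mulr1 mulrA [sfinv x * x]mulrC xx.
rewrite mul1r => h; rewrite mulr_natl mulr2n; split; last by rewrite addrC.
by apply: sle_add2l; apply: sle_trans le1x.
Qed.

(** Substitute for additive cancellation: if [b < c], then the hypothesis makes
    [c / b > 1] absorbing, and [F] would be max-tropical. *)
Lemma sle_addI_max b c : ~ max_tropical F -> b != 0 -> c != 0 -> b ∼ c ->
  c + c <= b + c -> c <= b.
Proof.
move=> nmax b0 c0 bc h.
have [//|[lebc nlecb]] := fully_le_or_lt full (sconn_sym bc).
have bb := sfmulV b0; case: nmax.
have bcE : b * (sfinv b * c) = c by rewrite mulrA bb mul1r.
apply: (@max_tropical_of_absorbing (sfinv b * c)).
- exact: sfmul_neq0 (sfinv_neq0 b0) c0.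
- split; first by apply: (sle_mulI b0); rewrite mulr1 bcE.
  by move/(sle_mul2l b); rewrite mulr1 bcE.
- by apply: (sle_mulI b0); rewrite !mulrDr mulr1 bcE.
Qed.

End Nontrivial.

Lemma sle_addI_min (F : preorderedSemifield) (b c : F) :
  fully_preordered F -> mul_archimedean F -> nontrivially_preordered F ->
  ~ min_tropical F -> b != 0 -> c != 0 -> b ∼ c -> b + c <= c + c -> b <= c.
Proof.
move=> full arch nontriv nmin b0 c0 bc h.
apply: (@sle_addI_max (opposite F) _ _ _ b c _ b0 c0 _ h).
- exact: nontrivially_preordered_opposite.
- exact: fully_preordered_opposite.
- exact: mul_archimedean_opposite.
- by move=> hmax; apply: nmin; apply: max_tropical_opposite hmax.
- exact/sconn_opposite.
Qed.

(** * The sequence of the [x ^+ n + x ^- n] *)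

(** Twice the hyperbolic cosine of [n * log x]. *)
Definition cosh2 (F : semifieldType) (x : F) (n : nat) : F :=
  x ^+ n + sfinv x ^+ n.

Lemma cosh2_mul (F : semifieldType) (x : F) n : x != 0 ->
  (x + sfinv x) * cosh2 x n.+1 = cosh2 x n.+2 + cosh2 x n.
Proof.
move=> /sfmulV xx; rewrite /cosh2 mulrDl !mulrDr -!exprS.
have -> : x * sfinv x ^+ n.+1 = sfinv x ^+ n by rewrite exprS mulrA xx mul1r.
have -> : sfinv x * x ^+ n.+1 = x ^+ n.
  by rewrite exprS mulrA [sfinv x * x]mulrC xx mul1r.
by rewrite [x ^+ n + sfinv x ^+ n]addrC [RHS]addrACA [sfinv x ^+ n.+2 + _]addrC.
Qed.

Lemma sconn_sfinv (F : preorderedSemifield) (x : F) :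
  x != 0 -> x ∼ 1 -> sfinv x ∼ 1.
Proof.
move=> x0 x1; have := sconn_mul (rst_refl _ _ (sfinv x)) x1.
by rewrite mulr1 mulrC sfmulV // => /sconn_sym.
Qed.

Lemma cosh2_sconn (F : preorderedSemifield) (x : F) n :
  x != 0 -> x ∼ 1 -> cosh2 x n ∼ 2.
Proof.
move=> x0 x1; rewrite mulr2n.
by apply: sconn_add; apply: sconn_exp => //; apply: sconn_sfinv.
Qed.

Lemma cosh2_neq0 (F : preorderedSemifield) (x : F) n :
  nontrivially_preordered F -> x != 0 -> cosh2 x n != 0.
Proof. by move=> nt x0; apply: sfadd_neq0 => //; apply: sfexp_neq0. Qed.

(** When [2 <= cosh2 x 1], the recurrence reads as convexity,
    [2 cosh2 x n.+1 <= cosh2 x n.+2 + cosh2 x n], and convexity propagates the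
    initial increase [cosh2 x 0 <= cosh2 x 1]. *)
Lemma cosh2_nondecreasing (F : preorderedSemifield) (x : F) n :
  fully_preordered F -> mul_archimedean F -> nontrivially_preordered F ->
  ~ max_tropical F -> x != 0 -> x ∼ 1 -> 2 <= x + sfinv x ->
  cosh2 x n <= cosh2 x n.+1.
Proof.
move=> full arch nt nmax x0 x1 h; elim: n => [//|n IHn].
apply: sle_addI_max; rewrite ?cosh2_neq0 //.
  apply: sconn_trans (cosh2_sconn _ x0 x1) (sconn_sym (cosh2_sconn _ x0 x1)).
have := sle_mul2r (cosh2 x n.+1) h; rewrite cosh2_mul // mulr_natl mulr2n.
by move=> {}h; apply: (sle_trans h); apply: sle_add2l.
Qed.

Lemma cosh2_nonincreasing (F : preorderedSemifield) (x : F) n :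
  fully_preordered F -> mul_archimedean F -> nontrivially_preordered F ->
  ~ min_tropical F -> x != 0 -> x ∼ 1 -> x + sfinv x <= 2 ->
  cosh2 x n.+1 <= cosh2 x n.
Proof.
move=> full arch nt nmin x0 x1 h.
apply: (@cosh2_nondecreasing (opposite F) x n) => //.
- exact: fully_preordered_opposite.
- exact: mul_archimedean_opposite.
- exact: nontrivially_preordered_opposite.
- by move=> hmax; apply: nmin; apply: max_tropical_opposite hmax.
- exact/sconn_opposite.
Qed.

Lemma cosh2_ge2 (F : preorderedSemifield) (x : F) n :
  fully_preordered F -> mul_archimedean F -> nontrivially_preordered F ->
  ~ max_tropical F -> x != 0 -> x ∼ 1 -> 2 <= x + sfinv x -> 2 <= cosh2 x n.
Proof.
move=> full arch nt nmax x0 x1 h; elim: n => [|n IHn]; first exact: slexx.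
by apply: sle_trans IHn _; apply: cosh2_nondecreasing.
Qed.

(** Let [n > 0]; write [c] for the right-hand side and [b] for the left-hand
    side.  By the recurrence, [2 c = b + 2 cosh2 x n.-1], so if [c <= b] then
    [2 c >= c + 2 cosh2 x n] as the sequence is nonincreasing.  Cancelling,
    [2 cosh2 x n <= c], that is [2 <= x + x^-1], a contradiction. *)
Lemma cosh2_decay (F : preorderedSemifield) (x : F) n :
  fully_preordered F -> mul_archimedean F -> nontrivially_preordered F ->
  ~ min_tropical F -> x != 0 -> x ∼ 1 -> x + sfinv x < 2 ->
  2 * cosh2 x n.+1 <= (x + sfinv x) * cosh2 x n.
Proof.
move=> full arch nt nmin x0 x1 [le2 nle2]; case: n => [|n].
  by rewrite mulrC; apply: slexx.
have a2 k : cosh2 x k ∼ 2 by apply: cosh2_sconn.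
have s0 : x + sfinv x != 0 by rewrite sfadd_neq0.
have sc k : 2 * cosh2 x k ∼ (x + sfinv x) * cosh2 x n.+1.
  apply: sconn_mul; first exact: sconn_sym (a2 1%N).
  exact: sconn_trans (a2 k) (sconn_sym (a2 _)).
have [//|h] := full _ _ (sc n.+2); case: nle2.
have a0 := cosh2_neq0 n.+1 nt x0.
apply: (sle_mulI a0); rewrite mulrC [X in _ <= X]mulrC.
apply: sle_addI_min => //; rewrite ?sfmul_neq0 ?sf2_neq0 //.
rewrite addrC.
have -> : (x + sfinv x) * cosh2 x n.+1 + (x + sfinv x) * cosh2 x n.+1
        = 2 * cosh2 x n.+2 + 2 * cosh2 x n.
  by rewrite cosh2_mul // addrACA !mulr_natl !mulr2n.
apply: sle_add => //; apply: sle_mul2l; exact: cosh2_nonincreasing.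
Qed.

(** * Comparing two elements *)

(** Starting from [k] makes the exponent of [z] as large as desired, so [x]
    and [z] may be compared at arbitrarily large scales although neither need
    be a power of the other. *)
Lemma interleaved_pow (F : preorderedSemifield) (x z : F) k :
  fully_preordered F -> mul_archimedean F ->
  x != 0 -> z != 0 -> 1 < x -> 1 < z ->
  exists n d, z ^+ (k + d) <= x ^+ n /\ x ^+ n <= z ^+ (k + d).+1.
Proof.
move=> full arch x0 z0 x1 z1.
have xc : x ∼ 1 by apply: sconn_sym; apply: sconn_le; case: x1.
have zc : z ∼ 1 by apply: sconn_sym; apply: sconn_le; case: z1.
have zS m : z ^+ m <= z ^+ m.+1.
  by rewrite exprSr -[X in X <= _]mulr1; apply: sle_mul2l; case: z1.
have [n kn] :=
  archimedean_pow full arch x0 (sfexp_neq0 k z0) x1 (sconn_exp k zc).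
have [e ne] :=
  archimedean_pow full arch z0 (sfexp_neq0 n x0) z1 (sconn_exp n xc).
(* Lower the exponent [k + e] until [x ^+ n] is bracketed. *)
exists n; have {ne} : x ^+ n <= z ^+ (k + e).
  apply: (sle_trans ne); rewrite addnC exprD -[X in X <= _]mulr1.
  by apply: sle_mul2l; apply: sexp_ge1; case: z1.
elim: e => [|e IHe] ne.
  exists 0%N; split; first by rewrite addn0.
  by apply: (sle_trans ne); apply: zS.
have nz : x ^+ n ∼ z ^+ (k + e).
  by apply: sconn_trans (sconn_exp _ xc) (sconn_sym (sconn_exp _ zc)).
have [/IHe // | en] := full _ _ nz.
by exists e; split; rewrite // -addnS.
Qed.

(** Let [v = 2 / (z + z^-1) >= 1].  Then [v ^+ m * cosh2 z m <= 2] for all [m].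
    If [2 <= x + x^-1], then [2 <= cosh2 x n <= z * cosh2 z m] whenever [x ^+ n]
    lies between [z ^+ m] and [z ^+ m.+1].  Hence the powers of [v] are bounded
    by [z], and the Archimedean property yields [v <= 1], that is
    [2 <= z + z^-1]. *)
Lemma add_sfinv_lt2 (F : preorderedSemifield) (x z : F) :
  fully_preordered F -> mul_archimedean F -> nontrivially_preordered F ->
  ~ max_tropical F -> ~ min_tropical F ->
  z != 0 -> 1 < z -> z + sfinv z < 2 -> x != 0 -> 1 < x -> x + sfinv x < 2.
Proof.
move=> full arch nt nmax nmin z0 z1 sz x0 x1.
have xc : x ∼ 1 by apply: sconn_sym; apply: sconn_le; case: x1.
have zc : z ∼ 1 by apply: sconn_sym; apply: sconn_le; case: z1.
have x2 : 2 ∼ x + sfinv x by apply: sconn_sym; apply: (cosh2_sconn 1).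
have [sx|//] := fully_le_or_lt full x2.
have [le2 nle2] := sz; case: nle2.
have s0 : z + sfinv z != 0 by rewrite sfadd_neq0.
pose v := 2 * sfinv (z + sfinv z).
have vs : v * (z + sfinv z) = 2.
  by rewrite -mulrA [_ * (z + _)]mulrC sfmulV ?mulr1.
have v0 : v != 0 by rewrite sfmul_neq0 ?sf2_neq0 ?sfinv_neq0.
have v1 : 1 <= v.
  have := sle_mul2l (sfinv (z + sfinv z)) le2.
  by rewrite mulrC sfmulV // mulrC.
have decay m : v ^+ m * cosh2 z m <= 2.
  elim: m => [|m IHm]; first by rewrite mul1r; apply: slexx.
  apply: sle_trans IHm; rewrite exprSr -mulrA; apply: sle_mul2l.
  apply: (sle_mulI s0); rewrite mulrA [_ * v]mulrC vs.
  exact: cosh2_decay.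
suff v_le1 : v <= 1.
  by have := sle_mul2r (z + sfinv z) v_le1; rewrite vs mul1r.
apply: (arch _ z) => // k; apply: (sle_mulI (sf2_neq0 nt)).
have [n [d [ln nl]]] := interleaved_pow k full arch x0 z0 x1 z1.
have xz : cosh2 x n <= z * cosh2 z (k + d).
  rewrite mulrDr -exprS; apply: sle_add => //.
  have VX (y : F) (y0 : y != 0) j : y ^+ j * sfinv y ^+ j = 1.
    by rewrite -exprMn sfmulV // expr1n.
  apply: (sle_trans (sle_inverse (VX z z0 _) (VX x x0 _) ln)).
  by rewrite -[X in X <= _]mul1r; apply: sle_mul2r; case: z1.
have {xz} xz := sle_trans (cosh2_ge2 n full arch nt nmax x0 xc sx) xz.
rewrite mulrC [X in _ <= X]mulrC.
apply: sle_trans (sle_mul2l z (decay (k + d)%N)).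
rewrite mulrCA; apply: sle_trans (sle_mul2l _ xz).
apply: sle_mul2r; rewrite exprD -[X in X <= _]mulr1.
by apply: sle_mul2l; apply: sexp_ge1.
Qed.

Lemma min_temperate_of_lt2 (F : preorderedSemifield) (z : F) :
  fully_preordered F -> mul_archimedean F -> nontrivially_preordered F ->
  ~ max_tropical F -> ~ min_tropical F ->
  z != 0 -> 1 < z -> z + sfinv z < 2 -> min_temperate F.
Proof.
move=> full arch nt nmax nmin z0 z1 sz x x0 x1.
split; last exact: add_sfinv_lt2 sz x0 x1.
have [le1x nlex1] := x1; have [lex1 _] := sfinv_lt1 x0 x1.
have x'x := sle_trans lex1 le1x; rewrite mulr_natl mulr2n.
split; first exact: sle_add2r.
move=> h; apply: nlex1; apply: sle_trans lex1.
exact: (sle_addI_min full arch nt nmin x0 (sfinv_neq0 x0)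
  (sconn_sym (sconn_le x'x)) h).
Qed.

Lemma max_temperate_of_gt2 (F : preorderedSemifield) (z : F) :
  fully_preordered F -> mul_archimedean F -> nontrivially_preordered F ->
  ~ max_tropical F -> ~ min_tropical F ->
  z != 0 -> 1 < z -> 2 < z + sfinv z -> max_temperate F.
Proof.
move=> full arch nt nmax nmin z0 z1 sz; apply: min_temperate_opposite.
apply: (@min_temperate_of_lt2 (opposite F) (sfinv z)).
- exact: fully_preordered_opposite.
- exact: mul_archimedean_opposite.
- exact: nontrivially_preordered_opposite.
- by move=> h; apply: nmin; apply: max_tropical_opposite.
- by move=> h; apply: nmax; apply: min_tropical_opposite.
- exact: sfinv_neq0.
- exact: sfinv_lt1.
- by rewrite sfinvK // addrC.
Qed.

(** The witness of nontriviality separates the five types, because [2] lies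
    strictly between [2 x^-1] and [2 x] for [x > 1]. *)
Lemma of_kind_unique (F : preorderedSemifield) (t t' : semifield_kind) :
  nontrivially_preordered F -> of_kind F t -> of_kind F t' -> t = t'.
Proof.
move=> nt; have [x [x0 x1]] := nt.
have [le1x nlex1] := x1; have [lex1 nle1x] := sfinv_lt1 x0 x1.
have hlo : ~ 2 <= 2 * sfinv x.
  by rewrite -[X in X <= _]mulr1 => /(sle_mulI (sf2_neq0 nt)).
have hhi : ~ 2 * x <= 2.
  by rewrite -[X in _ <= X]mulr1 => /(sle_mulI (sf2_neq0 nt)).
have lo : 2 * sfinv x <= 2.
  by rewrite -[X in _ <= X]mulr1; apply: sle_mul2l.
have hi : 2 <= 2 * x by rewrite -[X in X <= _]mulr1; apply: sle_mul2l.
case: t => /(_ x x0 x1) h; case: t' => /(_ x x0 x1) h' //; exfalso;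
  move: h h'; rewrite /sequiv /slt => h h'; intuition eauto 4 using sle_trans.
Qed.

(** * The classification *)

Theorem proposition5p12 (F : preorderedSemifield)
    (hfull : fully_preordered F) (harch : mul_archimedean F)
    (hnontriv : nontrivially_preordered F) :
  exists! t : semifield_kind, of_kind F t.
Proof.
suff [t ht] : exists t, of_kind F t.
  by exists t; split=> // t'; apply: of_kind_unique.
have [|nmax] := classic (max_tropical F); first by exists MaxTropical.
have [|nmin] := classic (min_tropical F); first by exists MinTropical.
have [[z [z0 z1 sz]]|no_lt] :=
  classic (exists z : F, [/\ z != 0, 1 < z & z + sfinv z < 2]).
  by exists MinTemperate; apply: min_temperate_of_lt2 sz.
have [[z [z0 z1 sz]]|no_gt] :=
  classic (exists z : F, [/\ z != 0, 1 < z & 2 < z + sfinv z]).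
  by exists MaxTemperate; apply: max_temperate_of_gt2 sz.
exists Arctic => x x0 x1.
have xc : x ∼ 1 by apply: sconn_sym; apply: sconn_le; case: x1.
have x2 : x + sfinv x ∼ 2 by apply: (cosh2_sconn 1).
split.
  by have [//|gt2] := fully_le_or_lt hfull x2; case: no_gt; exists x.
have [//|lt2] := fully_le_or_lt hfull (sconn_sym x2).
by case: no_lt; exists x.
Qed.
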